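(* Let $f\in C^3(\mathbb{R},\mathbb{R})$ satisfy hypotheses (H1), (H2), (H3) listed in the context. Then there exist $\epsilon_1=\epsilon_1(f)>0$ and $K_1=K_1(f)>0$ (depending only on $f$, not on $\zeta$ or $h$) such that, for $0\le\zeta-1\le\epsilon_1$ and every delay $h\ge 0$, every bounded solution $x:\mathbb{R}\to\mathbb{R}$ (defined on the whole real line) of $$x'(t)=-x(t)+\zeta f(x(t-h))$$ satisfies the inequality $$\sup_{t\in\mathbb{R}}|x(t)|\le K_1(\zeta-1)^{1/2}.$$
   Context: Hypotheses on $f\in C^3(\mathbb{R},\mathbb{R})$: (H1) $xf(x)<0$ for all $x\neq 0$, and $f'(0)=-1$. (H2) $f$ is bounded below and there exists at most one point $x^*\in\mathbb{R}$ such that $f'(x^* )=0$; moreover, if it exists, $x^*$ is a local extremum of $f$. (H3) $(Sf)(x)<0$ for all $x\neq x^*$ (for all $x\in\mathbb{R}$ if no such $x^*$ exists), where $Sf=\frac{f'''}{f'}-\frac32\left(\frac{f''}{f'}\right)^2$ is the Schwarz derivative of $f$. *)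

(* Defs.v *)
From Stdlib Require Import Reals.
From Coquelicot Require Import Coquelicot.
Open Scope R_scope.

Definition class_C (n : nat) (f : R -> R) : Prop :=
  (forall k : nat, (k <= n)%nat -> forall x : R, ex_derive_n f k x) /\
  (forall x : R, continuous (Derive_n f n) x).

Definition bounded_below (f : R -> R) : Prop :=
  exists m : R, forall x : R, m <= f x.

Definition local_extremum (f : R -> R) (a : R) : Prop :=
  locally a (fun x => f x <= f a) \/ locally a (fun x => f a <= f x).

Definition critical_point (f : R -> R) (a : R) : Prop := Derive f a = 0.

(** Since division is total on [R], the value is meaningful only where
    [Derive f x <> 0]. *)
Definition Schwarz (f : R -> R) (x : R) : R :=
  Derive_n f 3 x / Derive f x - 3 / 2 * (Derive_n f 2 x / Derive f x) ^ 2.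

Definition H1 (f : R -> R) : Prop :=
  (forall x : R, x <> 0 -> x * f x < 0) /\ Derive f 0 = -1.

Definition H2 (f : R -> R) : Prop :=
  bounded_below f /\
  (forall a b : R, critical_point f a -> critical_point f b -> a = b) /\
  (forall a : R, critical_point f a -> local_extremum f a).

(** The premise says that [x] differs from the critical point of [f], and is
    vacuous when there is none. *)
Definition H3 (f : R -> R) : Prop :=
  forall x : R, (forall a : R, critical_point f a -> x <> a) -> Schwarz f x < 0.

Definition entire_solution (f : R -> R) (zeta h : R) (x : R -> R) : Prop :=
  forall t : R, is_derive x t (- x t + zeta * f (x (t - h))).

Definition bounded_fun (x : R -> R) : Prop :=
  exists B : R, forall t : R, Rabs (x t) <= B.

Definition sup_abs (x : R -> R) : Rbar :=
  Lub_Rbar (fun r => exists t : R, r = Rabs (x t)).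

(* Main.v *)
Require Import Defs.
From Stdlib Require Import Reals Lra.
From Coquelicot Require Import Coquelicot.
Open Scope R_scope.

(** A bounded entire solution satisfies [zeta * f q <= x t <= zeta * f p], where
    [p <= 0 <= q] are a maximizer of [f] to the left of [0] and a minimizer to the
    right of [0] over the hull of the range of [x] and [0]; hence
    [q <= zeta * f p] and [zeta * f q <= p], whatever the delay. On [(p, q)] the
    derivative of [f] is negative. A negative Schwarz derivative makes
    [(- f') ^ (-1/2)] convex, which is why [1 / f x + 1 / x] strictly decreases
    through its limit [- f'' 0 / 2] at [0]: with some [c > 0], it is at most
    [- f'' 0 / 2 - c * q] at [q] and at least [- f'' 0 / 2 + c * |p|] at [p].
    Subtracting, the inequalities relating [p] and [q] give
    [c * q * |p| <= zeta - 1], while [q] and [|p|] are comparable because [f] grows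
    at most linearly on bounded sets. *)

(** * Calculus on the real line *)

(** [auto_derive] leaves [Derive] of an eta-expanded function; this replaces it by its known
    value. *)
Ltac derive_value H :=
  match type of H with
  | is_derive ?g ?x ?l =>
      rewrite ?(is_derive_unique (fun y : R => g y) x l H)
  end.

Lemma mean_value (g dg : R -> R) (a b : R) :
  a < b -> (forall x, a <= x <= b -> is_derive g x (dg x)) ->
  exists c, a < c < b /\ g b - g a = dg c * (b - a).
Proof.
  intros ab Hg.
  destruct (MVT_cor2 g dg a b ab) as [c [E Hc]].
  - intros x Hx. apply is_derive_Reals, Hg, Hx.
  - exists c. split; assumption.
Qed.

Lemma nonneg_of_second_derivative (g g1 g2 : R -> R) (b : R) :
  (forall x, 0 <= x <= b -> is_derive g x (g1 x)) ->
  (forall x, 0 <= x <= b -> is_derive g1 x (g2 x)) ->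
  g 0 = 0 -> g1 0 = 0 -> (forall x, 0 < x < b -> 0 <= g2 x) ->
  forall x, 0 <= x <= b -> 0 <= g x.
Proof.
  intros Hg Hg1 g0 g10 Hg2.
  assert (P1 : forall x, 0 <= x <= b -> 0 <= g1 x).
  { intros x Hx. destruct (Req_dec x 0) as [->|nz]; [lra|].
    destruct (mean_value g1 g2 0 x) as [c [Hc E]]; [lra| |].
    - intros y Hy. apply Hg1. lra.
    - assert (0 <= g2 c) by (apply Hg2; lra). nra. }
  intros x Hx. destruct (Req_dec x 0) as [->|nz]; [lra|].
  destruct (mean_value g g1 0 x) as [c [Hc E]]; [lra| |].
  - intros y Hy. apply Hg. lra.
  - assert (0 <= g1 c) by (apply P1; lra). nra.
Qed.

Lemma continuous_near (g : R -> R) (a eps : R) :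
  continuous g a -> 0 < eps ->
  exists d, 0 < d /\ forall x, Rabs (x - a) < d -> Rabs (g x - g a) < eps.
Proof.
  intros Hg He.
  destruct (Hg (ball (g a) (mkposreal eps He))) as [d Hd].
  - exists (mkposreal eps He). intros y Hy. exact Hy.
  - exists d. split; [apply cond_pos|]. intros x Hx. apply Hd, Hx.
Qed.

Lemma is_derive_continuous (g : R -> R) (x l : R) :
  is_derive g x l -> continuous g x.
Proof. intros H. apply (ex_derive_continuous g). exists l. exact H. Qed.

(** * Feedback functions and their reflection *)

(** The derivatives are explicit functions, so that those of the reflection [- f (- x)] can be
    named. [bounded_below] is kept apart because this reflection does not preserve it. *)
Record feedback (f f1 f2 f3 : R -> R) : Prop := {
  fb_derive1 : forall x, is_derive f x (f1 x);
  fb_derive2 : forall x, is_derive f1 x (f2 x);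
  fb_derive3 : forall x, is_derive f2 x (f3 x);
  fb_continuous3 : forall x, continuous f3 x;
  fb_sign : forall x, x <> 0 -> x * f x < 0;
  fb_slope : f1 0 = -1;
  fb_unique : forall a b, f1 a = 0 -> f1 b = 0 -> a = b;
  fb_extremum : forall a, f1 a = 0 -> local_extremum f a;
  fb_schwarz : forall x, f1 x <> 0 ->
    f3 x / f1 x - 3 / 2 * (f2 x / f1 x) ^ 2 < 0
}.

(** Estimates on the positive side thereby carry over to the negative side. Minima and maxima swap;
    in the Schwarz derivative [f2 / f1] only changes sign, and it enters squared. *)
Lemma feedback_reflect f f1 f2 f3 :
  feedback f f1 f2 f3 ->
  feedback (fun x => - f (- x)) (fun x => f1 (- x))
           (fun x => - f2 (- x)) (fun x => f3 (- x)).
Proof.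
  assert (D : forall g g1 : R -> R, (forall x, is_derive g x (g1 x)) ->
            forall x, is_derive (fun y => g (- y)) x (- g1 (- x))).
  { intros g g1 H x. auto_derive.
    - exists (g1 (- x)). apply H.
    - derive_value (H (- x)). ring. }
  intros [D1 D2 D3 C3 S0 S1 U E Sc]. split.
  - intros x. rewrite <- (Ropp_involutive (f1 (- x))).
    apply (is_derive_opp (fun y => f (- y))), D, D1.
  - apply D, D2.
  - intros x. rewrite <- (Ropp_involutive (f3 (- x))).
    apply (is_derive_opp (fun y => f2 (- y))), D, D3.
  - intros x. apply (continuous_comp Ropp f3); [|apply C3].
    apply (continuous_opp (fun y : R => y)), continuous_id.
  - intros x nz. specialize (S0 (- x)). lra.
  - rewrite Ropp_0. exact S1.
  - intros a b Ha Hb. specialize (U _ _ Ha Hb). lra.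
  - intros a Ha.
    assert (B : forall (d : posreal) y, ball a d y -> ball (- a) d (- y)).
    { intros d y Hy. change (Rabs (- y - - a) < d).
      change (Rabs (y - a) < d) in Hy.
      replace (- y - - a) with (- (y - a)) by ring. rewrite Rabs_Ropp. exact Hy. }
    destruct (E _ Ha) as [[d Hd]|[d Hd]]; [right|left]; exists d; intros y Hy;
      specialize (Hd (- y) (B d y Hy)); lra.
  - intros x Hx. specialize (Sc _ Hx). replace (- f2 (- x) / f1 (- x)) with
      (- (f2 (- x) / f1 (- x))) by (field; exact Hx). nra.
Qed.

(** The sign condition is silent at [0]. By continuity a nonzero [f 0] would impose its sign on both
    sides of [0]. *)
Lemma feedback_zero f f1 f2 f3 : feedback f f1 f2 f3 -> f 0 = 0.
Proof.
  intros F. destruct (Req_dec (f 0) 0) as [E|nz]; [exact E|exfalso].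
  destruct (continuous_near f 0 (Rabs (f 0))) as [d [Hd C]].
  - apply is_derive_continuous with (f1 0), (fb_derive1 _ _ _ _ F).
  - now apply Rabs_pos_lt.
  - assert (A := C (d / 2)). assert (B := C (- (d / 2))).
    assert (SA := fb_sign _ _ _ _ F (d / 2)). assert (SB := fb_sign _ _ _ _ F (- (d / 2))).
    assert (Rabs (d / 2 - 0) < d) as HA by (apply Rabs_def1; lra).
    assert (Rabs (- (d / 2) - 0) < d) as HB by (apply Rabs_def1; lra).
    specialize (A HA). specialize (B HB).
    assert (f (d / 2) < 0) by (assert (d / 2 * f (d / 2) < 0) by (apply SA; lra); nra).
    assert (0 < f (- (d / 2))) by (assert (- (d / 2) * f (- (d / 2)) < 0) by (apply SB; lra); nra).
    apply Rabs_def2 in A. apply Rabs_def2 in B.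
    destruct (Rle_dec 0 (f 0)); [rewrite Rabs_pos_eq in A, B by lra|rewrite Rabs_left in A, B by lra]; lra.
Qed.

Lemma feedback_neg f f1 f2 f3 x : feedback f f1 f2 f3 -> 0 < x -> f x < 0.
Proof.
  intros F Hx. assert (x * f x < 0) by (apply (fb_sign _ _ _ _ F); lra). nra.
Qed.

Lemma feedback_slope_continuity f f1 f2 f3 : feedback f f1 f2 f3 -> continuity f1.
Proof.
  intros F x. apply continuity_pt_filterlim, is_derive_continuous with (f2 x).
  apply (fb_derive2 _ _ _ _ F).
Qed.

(** * Monotonicity up to the extremal points *)

Lemma negative_of_no_zero (g : R -> R) (a b : R) :
  continuity g -> a <= b -> (forall c, a <= c <= b -> g c <> 0) ->
  g a < 0 -> g b < 0.
Proof.
  intros Hg ab nz Ha. destruct (Rlt_dec (g b) 0) as [L|L]; [exact L|exfalso].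
  destruct (IVT_gen g a b 0 Hg) as [c [Hc E]].
  - rewrite Rmin_left, Rmax_right; lra.
  - rewrite Rmin_left, Rmax_right in Hc by lra. exact (nz c Hc E).
Qed.

(** Otherwise [f1], which starts at [-1], vanishes at some [a] with [0 < a < q], its only zero.
    Either sign of [f1 q] then leads to a contradiction. *)
Lemma decreasing_before_argmin f f1 f2 f3 (M q : R) :
  feedback f f1 f2 f3 -> 0 <= q <= M ->
  (forall x, 0 <= x <= M -> f q <= f x) ->
  forall x, 0 <= x < q -> f1 x < 0.
Proof.
  intros F Hq Hmin x Hx.
  destruct (Rlt_dec (f1 x) 0) as [L|L]; [exact L|exfalso].
  assert (C := feedback_slope_continuity _ _ _ _ F).
  assert (s0 := fb_slope _ _ _ _ F).
  destruct (IVT_gen f1 0 x 0 C) as [a [Ha Ea]].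
  { rewrite Rmin_left, Rmax_right; lra. }
  rewrite Rmin_left, Rmax_right in Ha by lra.
  assert (U := fun b => fb_unique _ _ _ _ F a b Ea).
  assert (a0 : 0 < a). { destruct (Req_dec a 0) as [->|]; lra. }
  assert (Lneg : forall b, 0 <= b < a -> f1 b < 0).
  { intros b Hb. apply (negative_of_no_zero f1 0 b C); try lra.
    intros c Hc Ec. specialize (U c Ec). lra. }
  destruct (Rlt_dec (f1 q) 0) as [N|N].
  (* Here [f] decreases strictly through [a], which is then no local extremum. *)
  - assert (Rneg : forall b, a < b <= q -> f1 b < 0).
    { intros b Hb.
      destruct (Rtotal_order (f1 b) 0) as [T|[T|T]]; [exact T| |].
      - specialize (U b T). lra.
      - exfalso. destruct (IVT_gen f1 b q 0 C) as [c [Hc Ec]].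
        { rewrite Rmin_right, Rmax_left; lra. }
        rewrite Rmin_left, Rmax_right in Hc by lra. specialize (U c Ec). lra. }
    assert (Dl : forall y, 0 <= y < a -> f a < f y).
    { intros y Hy. destruct (mean_value f f1 y a) as [c [Hc Ec]]; [lra| |].
      - intros; apply (fb_derive1 _ _ _ _ F).
      - assert (f1 c < 0) by (apply Lneg; lra). nra. }
    assert (Dr : forall y, a < y <= q -> f y < f a).
    { intros y Hy. destruct (mean_value f f1 a y) as [c [Hc Ec]]; [lra| |].
      - intros; apply (fb_derive1 _ _ _ _ F).
      - assert (f1 c < 0) by (apply Rneg; lra). nra. }
    destruct (fb_extremum _ _ _ _ F a Ea) as [[d Hd]|[d Hd]]; assert (Pd := cond_pos d).
    + set (y := Rmax 0 (a - d / 2)).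
      assert (0 <= y < a /\ a - d / 2 <= y).
      { unfold y. split; [split; [apply Rmax_l|apply Rmax_lub_lt; lra]|apply Rmax_r]. }
      assert (ball a d y) as B by (apply Rabs_def1; simpl; unfold minus, plus, opp; simpl; lra).
      specialize (Hd y B). specialize (Dl y). lra.
    + set (y := Rmin q (a + d / 2)).
      assert (a < y <= q /\ y <= a + d / 2).
      { unfold y. split; [split; [apply Rmin_glb_lt; lra|apply Rmin_l]|apply Rmin_r]. }
      assert (ball a d y) as B by (apply Rabs_def1; simpl; unfold minus, plus, opp; simpl; lra).
      specialize (Hd y B). specialize (Dr y). lra.
  (* With a positive slope at [q], the inequality [f q <= f a] forces a nonpositive slope in
     between, hence a second zero of [f1]. *)
  - assert (P : f1 q > 0).
    { destruct (Req_dec (f1 q) 0) as [T|T]; [specialize (U q T); lra|lra]. }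
    destruct (mean_value f f1 a q) as [c [Hc Ec]]; [lra| |].
    + intros; apply (fb_derive1 _ _ _ _ F).
    + assert (f a >= f q) by (apply Rle_ge, Hmin; lra).
      assert (f1 c <= 0) by nra.
      destruct (IVT_gen f1 c q 0 C) as [b [Hb Eb]].
      { rewrite Rmin_left, Rmax_right; lra. }
      rewrite Rmin_left, Rmax_right in Hb by lra. specialize (U b Eb). lra.
Qed.

(** * Convexity from the negative Schwarz derivative *)

(** For [f1 < 0], [weight2] is [- weight / 2] times the Schwarz derivative, so
    a negative Schwarz derivative means that [weight] is convex. *)
Definition weight (f1 : R -> R) (x : R) : R := / sqrt (- f1 x).
Definition weight1 (f1 f2 : R -> R) (x : R) : R := f2 x / 2 * weight f1 x ^ 3.
Definition weight2 (f1 f2 f3 : R -> R) (x : R) : R :=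
  f3 x / 2 * weight f1 x ^ 3 + 3 / 4 * f2 x ^ 2 * weight f1 x ^ 5.

Lemma weight_pos f1 x : f1 x < 0 -> 0 < weight f1 x.
Proof. intros H. apply Rinv_0_lt_compat, sqrt_lt_R0. lra. Qed.

Lemma weight_sqr f1 x : f1 x < 0 -> weight f1 x ^ 2 * - f1 x = 1.
Proof.
  intros H. unfold weight. assert (0 < sqrt (- f1 x)) by (apply sqrt_lt_R0; lra).
  rewrite <- (sqrt_sqrt (- f1 x)) at 2 by lra. field. lra.
Qed.

Lemma weight_derive (f1 f2 : R -> R) x :
  is_derive f1 x (f2 x) -> f1 x < 0 -> is_derive (weight f1) x (weight1 f1 f2 x).
Proof.
  intros D N. assert (0 < sqrt (- f1 x)) by (apply sqrt_lt_R0; lra).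
  unfold weight1, weight. auto_derive.
  - repeat split; try lra. now exists (f2 x).
  - derive_value D. field. lra.
Qed.

Lemma weight1_derive (f1 f2 f3 : R -> R) x :
  is_derive f1 x (f2 x) -> is_derive f2 x (f3 x) -> f1 x < 0 ->
  is_derive (weight1 f1 f2) x (weight2 f1 f2 f3 x).
Proof.
  intros D D2 N. assert (W := weight_derive f1 f2 x D N).
  unfold weight1 at 1. auto_derive.
  - split; [now exists (f3 x)|]. split; [|exact I]. now exists (weight1 f1 f2 x).
  - derive_value D2. derive_value W.
    unfold weight1, weight2. field.
Qed.

Lemma weight2_pos f f1 f2 f3 x : feedback f f1 f2 f3 -> f1 x < 0 -> 0 < weight2 f1 f2 f3 x.
Proof.
  intros F N. assert (P := weight_pos f1 x N). assert (Q := weight_sqr f1 x N).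
  assert (S := fb_schwarz _ _ _ _ F x ltac:(lra)).
  replace (weight2 f1 f2 f3 x) with
    (weight f1 x / 2 * - (f3 x / f1 x - 3 / 2 * (f2 x / f1 x) ^ 2)); [nra|].
  assert (E : / f1 x = - weight f1 x ^ 2).
  { apply Rmult_eq_reg_r with (f1 x); [|lra]. rewrite Rinv_l; lra. }
  unfold weight2, Rdiv. rewrite E. field.
Qed.

(** * Decrease of the reciprocal sum *)

Section Defect.
Variables f f1 f2 f3 : R -> R.
Hypothesis F : feedback f f1 f2 f3.

(** For [x > 0] and [f1 x < 0], the derivative [- f1 / f ^ 2] of [/ f] equals
    [/ (x + defect x) ^ 2], so a nonnegative [defect] makes [/ f x + / x] nonincreasing. The second
    derivative of [defect] reduces to [- f * weight2], whose sign is known. *)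
Definition defect (x : R) : R := - f x * weight f1 x - x.
Definition defect1 (x : R) : R := - f1 x * weight f1 x - f x * weight1 f1 f2 x - 1.
Definition defect2 (x : R) : R := - f x * weight2 f1 f2 f3 x.

Lemma defect_derive x : f1 x < 0 -> is_derive defect x (defect1 x).
Proof.
  intros N. assert (D := fb_derive1 _ _ _ _ F x).
  assert (W := weight_derive f1 f2 x (fb_derive2 _ _ _ _ F x) N).
  unfold defect, defect1. auto_derive.
  - split; [now exists (f1 x)|]. split; [|exact I]. now exists (weight1 f1 f2 x).
  - derive_value D. derive_value W. ring.
Qed.

(* The terms [f2 * weight] and [2 * f1 * weight1] cancel because
   [weight ^ 2 * f1 = -1]. *)
Lemma defect1_derive x : f1 x < 0 -> is_derive defect1 x (defect2 x).
Proof.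
  intros N. assert (D := fb_derive1 _ _ _ _ F x).
  assert (D2 := fb_derive2 _ _ _ _ F x).
  assert (W := weight_derive f1 f2 x D2 N).
  assert (W1 := weight1_derive f1 f2 f3 x D2 (fb_derive3 _ _ _ _ F x) N).
  unfold defect1, defect2. auto_derive.
  - repeat split; eexists; eassumption.
  - derive_value D. derive_value D2. derive_value W. derive_value W1.
    assert (Q := weight_sqr f1 x N).
    transitivity (- f x * weight2 f1 f2 f3 x + f2 x * weight f1 x * (weight f1 x ^ 2 * - f1 x - 1)).
    + unfold weight1. field.
    + rewrite Q. ring.
Qed.

Lemma weight_zero : weight f1 0 = 1.
Proof.
  unfold weight. rewrite (fb_slope _ _ _ _ F). replace (- -1) with 1 by ring. rewrite sqrt_1. apply Rinv_1.
Qed.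

Lemma defect_zero : defect 0 = 0.
Proof. unfold defect. rewrite (feedback_zero _ _ _ _ F). ring. Qed.

Lemma defect1_zero : defect1 0 = 0.
Proof.
  unfold defect1. rewrite (feedback_zero _ _ _ _ F), weight_zero, (fb_slope _ _ _ _ F). ring.
Qed.

(** Both sides vanish at [0] with their first derivatives, so it suffices to compare second
    derivatives. The case [c = 0] gives the sign of [defect]; a positive [c] gives a rate near
    [0]. *)
Lemma defect_cubic (c b : R) :
  (forall x, 0 <= x <= b -> f1 x < 0) ->
  (forall x, 0 < x < b -> 6 * c * x <= defect2 x) ->
  forall x, 0 <= x <= b -> c * x ^ 3 <= defect x.
Proof.
  intros N L x Hx.
  assert (0 <= defect x - c * x ^ 3); [|lra].
  apply (nonneg_of_second_derivative (fun y => defect y - c * y ^ 3)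
    (fun y => defect1 y - 3 * c * y ^ 2) (fun y => defect2 y - 6 * c * y) b); auto.
  - intros y Hy. assert (D := defect_derive y (N y Hy)). auto_derive.
    + now exists (defect1 y).
    + derive_value D. ring.
  - intros y Hy. assert (D := defect1_derive y (N y Hy)). auto_derive.
    + now exists (defect2 y).
    + derive_value D. ring.
  - rewrite defect_zero. ring.
  - rewrite defect1_zero. ring.
  - intros y Hy. specialize (L y Hy). lra.
Qed.

Definition recip_sum (x : R) : R := / f x + / x.
Definition recip_sum1 (x : R) : R := - f1 x / f x ^ 2 - / x ^ 2.

Lemma recip_sum_derive x : 0 < x -> is_derive recip_sum x (recip_sum1 x).
Proof.
  intros Hx. assert (D := fb_derive1 _ _ _ _ F x).
  assert (f x < 0) by (apply (feedback_neg _ _ _ _ x F Hx)).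
  unfold recip_sum, recip_sum1. auto_derive.
  - repeat split; try lra. now exists (f1 x).
  - derive_value D. field. lra.
Qed.

Lemma recip_sum1_defect x : 0 < x -> f1 x < 0 -> recip_sum1 x = / (x + defect x) ^ 2 - / x ^ 2.
Proof.
  intros Hx N. assert (f x < 0) by (apply (feedback_neg _ _ _ _ x F Hx)).
  assert (P := weight_pos f1 x N). assert (Q := weight_sqr f1 x N).
  unfold recip_sum1, defect. f_equal.
  replace (- f1 x) with (/ weight f1 x ^ 2).
  - field. split; [|split]; nra.
  - apply Rmult_eq_reg_l with (weight f1 x ^ 2); [|nra]. rewrite Q. field. nra.
Qed.

Lemma recip_sum1_nonpos b x : (forall y, 0 <= y < b -> f1 y < 0) -> 0 < x < b -> recip_sum1 x <= 0.
Proof.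
  intros N Hx. rewrite recip_sum1_defect; [|lra|apply N; lra].
  assert (0 <= defect x).
  { rewrite <- (Rmult_0_l (x ^ 3)). apply (defect_cubic 0 x); [| |lra].
    - intros y Hy. apply N. lra.
    - intros y Hy. rewrite Rmult_0_r, Rmult_0_l. unfold defect2.
      assert (f y < 0) by (apply (feedback_neg _ _ _ _ y F); lra).
      assert (0 < weight2 f1 f2 f3 y) by (apply (weight2_pos f); [exact F|apply N; lra]). nra. }
  assert (/ (x + defect x) ^ 2 <= / x ^ 2); [|lra].
  apply Rinv_le_contravar; nra.
Qed.

(** Since [f1 0 = -1] and [weight2] is positive and continuous at [0], the product [- f * weight2]
    grows at least linearly to the right of [0]. The bound on [c * d ^ 2] serves a later expansion
    in [c * x ^ 2]. *)
Lemma near_zero :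
  exists d c, 0 < d /\ 0 < c /\ c * d ^ 2 <= / 2 /\
    (forall x, 0 <= x <= d -> f1 x < 0) /\
    (forall x, 0 <= x <= d -> f x <= - x / 2) /\
    (forall x, 0 < x < d -> 6 * c * x <= defect2 x).
Proof.
  assert (s0 := fb_slope _ _ _ _ F).
  assert (D2 := fb_derive2 _ _ _ _ F).
  destruct (continuous_near f1 0 (/ 2)) as [d1 [Hd1 C1]].
  { apply is_derive_continuous with (f2 0), D2. } { lra. }
  assert (Pw : 0 < weight2 f1 f2 f3 0) by (apply (weight2_pos f); [exact F|lra]).
  set (kap := weight2 f1 f2 f3 0 / 2).
  destruct (continuous_near (weight2 f1 f2 f3) 0 kap) as [d2 [Hd2 C2]].
  { assert (Cw : continuous (weight f1) 0).
    { apply is_derive_continuous with (weight1 f1 f2 0), weight_derive; [apply D2|lra]. }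
    assert (Cf2 : continuous f2 0).
    { apply is_derive_continuous with (f3 0), (fb_derive3 _ _ _ _ F). }
    assert (Pow : forall (g : R -> R) n, continuous g 0 -> continuous (fun x => g x ^ n) 0).
    { intros g n Hg. induction n; simpl; [apply continuous_const|].
      apply (continuous_mult g); assumption. }
    unfold weight2. apply (continuous_plus (fun x => f3 x / 2 * weight f1 x ^ 3)).
    - apply (continuous_mult (fun x => f3 x / 2)); [|now apply Pow].
      apply (continuous_mult f3); [apply (fb_continuous3 _ _ _ _ F)|apply continuous_const].
    - apply (continuous_mult (fun x => 3 / 4 * f2 x ^ 2)); [|now apply Pow].
      apply (continuous_mult (fun _ => 3 / 4)); [apply continuous_const|now apply Pow]. }
  { unfold kap. lra. }
  (* From [- f x >= x / 2] and [weight2 >= kap] comes [defect2 x >= x / 2 * kap = 6 * c * x]. *)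
  set (c := kap / 12). assert (Hc : 0 < c) by (unfold c, kap; lra).
  (* For [d <= d3] this gives [c * d ^ 2 <= c * d <= / 2]. *)
  set (d3 := Rmin 1 (/ (2 * c))).
  assert (Hd3 : 0 < d3) by (apply Rmin_glb_lt; [lra|apply Rinv_0_lt_compat; lra]).
  set (d := Rmin d3 (Rmin (d1 / 2) (d2 / 2))).
  assert (Hd : 0 < d) by (apply Rmin_glb_lt; [exact Hd3|apply Rmin_glb_lt; lra]).
  assert (B1 : d <= d3) by apply Rmin_l.
  assert (B2 : d <= d1 / 2) by (eapply Rle_trans; [apply Rmin_r|apply Rmin_l]).
  assert (B3 : d <= d2 / 2) by (eapply Rle_trans; [apply Rmin_r|apply Rmin_r]).
  assert (Nf1 : forall x, 0 <= x <= d -> f1 x < - / 2).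
  { intros x Hx. assert (A : Rabs (x - 0) < d1) by (apply Rabs_def1; lra).
    apply C1, Rabs_def2 in A. lra. }
  assert (Bf : forall x, 0 <= x <= d -> f x <= - x / 2).
  { intros x Hx. destruct (Req_dec x 0) as [->|nz].
    - rewrite (feedback_zero _ _ _ _ F). lra.
    - destruct (mean_value f f1 0 x) as [e [He E]]; [lra| |].
      + intros; apply (fb_derive1 _ _ _ _ F).
      + rewrite (feedback_zero _ _ _ _ F) in E.
        assert (f1 e < - / 2) by (apply Nf1; lra). nra. }
  exists d, c. repeat split; auto.
  - assert (d <= 1) by (apply Rle_trans with d3; [exact B1|apply Rmin_l]).
    assert (d <= / (2 * c)) by (apply Rle_trans with d3; [exact B1|apply Rmin_r]).
    assert (c * d <= / 2).
    { replace (/ 2) with (c * / (2 * c)) by (field; lra). apply Rmult_le_compat_l; lra. }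
    nra.
  - intros x Hx. specialize (Nf1 x Hx). lra.
  - intros x Hx. unfold defect2. assert (B := Bf x).
    assert (A : Rabs (x - 0) < d2) by (apply Rabs_def1; lra).
    apply C2, Rabs_def2 in A. unfold c. assert (kap < weight2 f1 f2 f3 x) by (unfold kap in *; lra).
    assert (0 < kap) by (unfold kap; lra).
    apply Rle_trans with (x / 2 * kap); [lra|]. apply Rmult_le_compat; lra.
Qed.

(** Multiplication by [x * - f x > 0] removes the singularity at [0]; the resulting inequality
    follows from second derivatives. *)
Lemma recip_sum_limsup eps :
  0 < eps -> exists d, 0 < d /\ forall x, 0 < x < d -> recip_sum x <= - f2 0 / 2 + eps.
Proof.
  intros He. destruct near_zero as [d [c [Hd [Hc [_ [_ [Bf _]]]]]]].
  set (a := f2 0 / 2).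
  (* [G2] is the second derivative of [s + f s + a * s * f s]; the choice of [a] makes it vanish at
     [0]. *)
  set (G2 := fun s => f2 s + 2 * a * f1 s + a * s * f2 s).
  assert (D1 := fb_derive1 _ _ _ _ F). assert (D2 := fb_derive2 _ _ _ _ F).
  destruct (continuous_near G2 0 eps) as [d' [Hd' C]]; [|exact He|].
  { apply (ex_derive_continuous G2). assert (D3 := fb_derive3 _ _ _ _ F).
    unfold G2. auto_derive. repeat split; eexists; [apply D3|apply D2|apply D3]. }
  exists (Rmin d d'). split; [now apply Rmin_glb_lt|]. intros x Hx.
  assert (x < d) by (apply Rlt_le_trans with (Rmin d d'); [lra|apply Rmin_l]).
  assert (x < d') by (apply Rlt_le_trans with (Rmin d d'); [lra|apply Rmin_r]).
  assert (P : 0 <= x + f x + a * x * f x + eps * x ^ 2 / 2).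
  { apply (nonneg_of_second_derivative
      (fun s => s + f s + a * s * f s + eps * s ^ 2 / 2)
      (fun s => 1 + f1 s + a * f s + a * s * f1 s + eps * s)
      (fun s => G2 s + eps) x); [| | | | |lra].
    - intros y _. auto_derive.
      + repeat split; eexists; apply D1.
      + derive_value (D1 y). field.
    - intros y _. auto_derive.
      + repeat split; eexists; [apply D2|apply D1|apply D2].
      + derive_value (D1 y). derive_value (D2 y).
        unfold G2. ring.
    - rewrite (feedback_zero _ _ _ _ F). field.
    - rewrite (feedback_zero _ _ _ _ F), (fb_slope _ _ _ _ F). ring.
    - intros y Hy. assert (A : Rabs (y - 0) < d') by (apply Rabs_def1; lra).
      apply C, Rabs_def2 in A.
      assert (G2 0 = 0) by (unfold G2; rewrite (fb_slope _ _ _ _ F); unfold a; field). lra. }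
  assert (B := Bf x ltac:(lra)).
  assert (0 < x * - f x) by nra.
  assert (E : recip_sum x - (- a + eps) =
    - (x + f x + a * x * f x + eps * x * - f x) / (x * - f x)).
  { unfold recip_sum. field. lra. }
  assert (recip_sum x - (- a + eps) <= 0); [|unfold a in *; lra].
  rewrite E. unfold Rdiv. assert (0 < / (x * - f x)) by (now apply Rinv_0_lt_compat).
  assert (0 <= x + f x + a * x * f x + eps * x * - f x); [|nra].
  assert (eps * x * (x / 2) <= eps * x * - f x).
  { apply Rmult_le_compat_l; nra. }
  lra.
Qed.

(** On [(0, d)] the slope of [recip_sum] is at most [- c], which is integrated from the limit at
    [0]. Further out the slope is only nonpositive, so the gain [c * d] reached at [d] has to serve
    all [q <= B]. *)
Lemma recip_sum_bound (B : R) :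
  exists c, 0 < c /\ forall q, 0 < q <= B ->
    (forall x, 0 <= x < q -> f1 x < 0) -> recip_sum q <= - f2 0 / 2 - c * q.
Proof.
  destruct near_zero as [d [c [Hd [Hc [Hcd [Nf1 [Bf Hdef]]]]]]].
  assert (Small : forall x, 0 < x <= d -> recip_sum x <= - f2 0 / 2 - c * x).
  { intros x Hx. apply le_epsilon. intros eps He.
    destruct (recip_sum_limsup (eps / 2)) as [d' [Hd' L]]; [lra|].
    (* The mean value theorem starts at [s] instead of [0]: half of [eps] pays for the limit, half
       for [c * s]. *)
    set (s := Rmin (Rmin (x / 2) (d' / 2)) (eps / (2 * c))).
    assert (0 < eps / (2 * c)) by (apply Rdiv_lt_0_compat; lra).
    assert (0 < s) by (repeat apply Rmin_glb_lt; lra).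
    assert (s <= x / 2) by (eapply Rle_trans; [apply Rmin_l|apply Rmin_l]).
    assert (s <= d' / 2) by (eapply Rle_trans; [apply Rmin_l|apply Rmin_r]).
    assert (c * s <= eps / 2).
    { replace (eps / 2) with (c * (eps / (2 * c))) by (field; lra).
      apply Rmult_le_compat_l; [lra|apply Rmin_r]. }
    destruct (mean_value recip_sum recip_sum1 s x) as [e [He' E]]; [lra| |].
    { intros y Hy. apply recip_sum_derive. lra. }
    assert (recip_sum1 e <= - c).
    { rewrite recip_sum1_defect; [|lra|apply Nf1; lra].
      assert (Q : c * e ^ 3 <= defect e) by (apply (defect_cubic c d); auto; lra).
      set (z := c * e ^ 2).
      assert (0 < z <= / 2).
      { unfold z. split; [apply Rmult_lt_0_compat; [lra|apply pow_lt; lra]|].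
        apply Rle_trans with (c * d ^ 2); [|exact Hcd].
        apply Rmult_le_compat_l; [lra|]. apply pow_incr. lra. }
      assert (0 < e * (1 + z)) by nra.
      assert (/ (e + defect e) ^ 2 <= / (e * (1 + z)) ^ 2).
      { apply Rinv_le_contravar; [now apply pow_lt|]. apply pow_incr.
        split; [lra|]. unfold z. lra. }
      (* This amounts to [1 <= (1 + z) ^ 2 * (1 - z)], true for [0 < z <= / 2]. *)
      assert (/ (e * (1 + z)) ^ 2 <= / e ^ 2 * (1 - z)).
      { apply Rmult_le_reg_l with ((e * (1 + z)) ^ 2); [now apply pow_lt|].
        rewrite Rinv_r by (apply pow_nonzero; lra).
        replace ((e * (1 + z)) ^ 2 * (/ e ^ 2 * (1 - z))) with ((1 + z) ^ 2 * (1 - z))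
          by (field; lra). nra. }
      replace (- c) with (/ e ^ 2 * (1 - z) - / e ^ 2); [lra|].
      unfold z. field. lra. }
    assert (L' := L s ltac:(lra)). nra. }
  (* The second entry spreads the gain [c * d] over lengths up to [B]; [Rmax 1 B] keeps the divisor
     positive. *)
  set (c' := Rmin c (c * d / Rmax 1 B)).
  assert (1 <= Rmax 1 B) by apply Rmax_l. assert (B <= Rmax 1 B) by apply Rmax_r.
  exists c'. split.
  { apply Rmin_glb_lt; [lra|]. apply Rdiv_lt_0_compat; nra. }
  intros q Hq N. destruct (Rle_dec q d) as [L|L].
  - assert (c' <= c) by apply Rmin_l. specialize (Small q). nra.
  - destruct (mean_value recip_sum recip_sum1 d q) as [e [He E]]; [lra| |].
    { intros y Hy. apply recip_sum_derive. lra. }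
    assert (recip_sum1 e <= 0) by (apply (recip_sum1_nonpos q); [exact N|lra]).
    assert (S := Small d ltac:(lra)).
    assert (c' * q <= c * d).
    { apply Rle_trans with (c * d / Rmax 1 B * Rmax 1 B); [|right; field; lra].
      apply Rmult_le_compat; [|lra|apply Rmin_r|lra].
      apply Rlt_le, Rmin_glb_lt; [lra|]. apply Rdiv_lt_0_compat; nra. }
    nra.
Qed.
End Defect.

(** * Comparison of the two extremal points *)

(** [recip_sum_bound] applies to [f] at [q] and to the reflection at [- p]. Their second derivatives
    at [0] are opposite, so the limits cancel in the sum. *)
Lemma pair_product_bound f f1 f2 f3 (B : R) :
  feedback f f1 f2 f3 ->
  exists c, 0 < c /\ forall zeta p q,
    - B <= p < 0 -> 0 < q <= B ->
    (forall x, 0 <= x < q -> f1 x < 0) ->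
    (forall x, 0 <= x < - p -> f1 (- x) < 0) ->
    q <= zeta * f p -> zeta * f q <= p ->
    c * (q * - p) <= zeta - 1.
Proof.
  intros F. assert (F' := feedback_reflect _ _ _ _ F).
  destruct (recip_sum_bound _ _ _ _ F B) as [c1 [Hc1 K1]].
  destruct (recip_sum_bound _ _ _ _ F' B) as [c2 [Hc2 K2]].
  exists (Rmin c1 c2). split; [now apply Rmin_glb_lt|].
  intros zeta p q Hp Hq Nq Np Iq Ip.
  specialize (K1 q Hq Nq). specialize (K2 (- p) ltac:(lra) Np). unfold recip_sum in K1, K2.
  rewrite Ropp_involutive, Ropp_0 in K2.
  assert (M1 := Rmin_l c1 c2). assert (M2 := Rmin_r c1 c2). set (c := Rmin c1 c2) in *.
  assert (fq : f q < 0) by (apply (feedback_neg _ _ _ _ q F); lra).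
  assert (fp : 0 < f p).
  { assert (P := feedback_neg _ _ _ _ (- p) F' ltac:(lra)).
    simpl in P. rewrite Ropp_involutive in P. lra. }
  set (u := - p) in *. assert (Hu : 0 < u) by (unfold u; lra).
  assert (E1 : / f p <= zeta * / q).
  { apply Rmult_le_reg_l with (q * f p); [nra|].
    replace (q * f p * / f p) with q by (field; lra).
    replace (q * f p * (zeta * / q)) with (zeta * f p) by (field; lra). exact Iq. }
  assert (E2 : / - f q <= zeta * / u).
  { apply Rmult_le_reg_l with (u * - f q); [nra|].
    replace (u * - f q * / - f q) with u by (field; lra).
    replace (u * - f q * (zeta * / u)) with (- (zeta * f q)) by (field; lra). unfold u. lra. }
  rewrite Rinv_opp in E2, K2.
  (* The sum of [K1], [K2], [E1] and [E2]; the factor [q + u] then cancels. *)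
  assert (S : c * (q + u) <= (zeta - 1) * (/ q + / u)) by nra.
  replace (/ q + / u) with ((q + u) / (q * u)) in S by (field; lra).
  apply Rmult_le_reg_r with ((q + u) / (q * u)).
  - apply Rdiv_lt_0_compat; nra.
  - replace (c * (q * u) * ((q + u) / (q * u))) with (c * (q + u)) by (field; lra). exact S.
Qed.

Lemma linear_growth f f1 f2 f3 (B : R) :
  feedback f f1 f2 f3 ->
  exists C, 0 < C /\ forall x, - B <= x <= B -> Rabs (f x) <= C * Rabs x.
Proof.
  intros F. destruct (bounded_continuity f1 (- B) B) as [C HC].
  { intros x _. apply is_derive_continuous with (f2 x), (fb_derive2 _ _ _ _ F). }
  assert (f0 := feedback_zero _ _ _ _ F).
  exists (Rmax C 1). split; [apply Rlt_le_trans with 1; [lra|apply Rmax_r]|].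
  intros x Hx.
  destruct (MVT_gen f 0 x f1) as [e [He E]].
  - intros y _. apply (fb_derive1 _ _ _ _ F).
  - intros y _. apply continuity_pt_filterlim, is_derive_continuous with (f1 y).
    apply (fb_derive1 _ _ _ _ F).
  - replace (f x) with (f1 e * x) by lra. rewrite Rabs_mult.
    apply Rmult_le_compat_r; [apply Rabs_pos|].
    apply Rle_trans with C; [|apply Rmax_l]. apply Rlt_le, HC.
    revert He. unfold Rmin, Rmax. destruct (Rle_dec 0 x); lra.
Qed.

(** * Bounds for bounded entire solutions *)

(** [exp s * (x s - G)] is nonincreasing and, [x] being bounded, tends to [0] as [s] goes to minus
    infinity; so it is never positive. *)
Lemma bounded_solution_le (x g : R -> R) (G : R) :
  bounded_fun x -> (forall t, is_derive x t (- x t + g t)) ->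
  (forall t, g t <= G) -> forall t, x t <= G.
Proof.
  intros [B HB] D HG t. destruct (Rle_dec (x t) G) as [L|L]; [exact L|exfalso].
  set (eta := x t - G). assert (He : 0 < eta) by (unfold eta; lra).
  set (C := B + Rabs G).
  assert (HC : forall s, x s - G <= C).
  { intros s. specialize (HB s). assert (P := Rle_abs (x s)). assert (Q := Rle_abs (- G)).
    rewrite Rabs_Ropp in Q. unfold C. lra. }
  assert (0 < C) by (apply Rlt_le_trans with (x t - G); [lra|apply HC]).
  (* Going back by [u] is long enough: an excess [eta] at [t] would need [exp u * eta <= C], yet
     [(1 + u) * eta = eta + C]. *)
  set (u := C / eta). assert (0 < u) by (apply Rdiv_lt_0_compat; lra).
  destruct (mean_value (fun s => exp (s - t) * (x s - G))
    (fun s => exp (s - t) * (g s - G)) (t - u) t) as [e [_ E]]; [lra| |].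
  - intros s _. auto_derive; [eexists; apply D|].
    derive_value (D s). unfold Rminus. ring.
  - assert (exp (e - t) * (g e - G) <= 0).
    { assert (P := exp_pos (e - t)). specialize (HG e). nra. }
    replace (t - t) with 0 in E by ring. rewrite exp_0 in E. fold eta in E.
    replace (t - u - t) with (- u) in E by ring.
    assert (A : eta <= exp (- u) * (x (t - u) - G)) by nra.
    assert (P := exp_pos (- u)).
    assert (A' : eta <= exp (- u) * C).
    { apply Rle_trans with (1 := A). apply Rmult_le_compat_l; [lra|apply HC]. }
    assert (Q : 1 + u <= exp u) by apply exp_ineq1_le.
    assert (R1 : exp u * exp (- u) = 1) by (rewrite <- exp_plus, Rplus_opp_r; apply exp_0).
    assert (A'' : exp u * eta <= C).
    { replace C with (exp u * (exp (- u) * C)) by (rewrite <- Rmult_assoc, R1; ring).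
      apply Rmult_le_compat_l; [apply Rlt_le, exp_pos|exact A']. }
    assert (u * eta = C) by (unfold u; field; lra). nra.
Qed.

Lemma bounded_solution_ge (x g : R -> R) (G : R) :
  bounded_fun x -> (forall t, is_derive x t (- x t + g t)) ->
  (forall t, G <= g t) -> forall t, G <= x t.
Proof.
  intros [B HB] D HG t.
  assert (- x t <= - G); [|lra].
  apply (bounded_solution_le (fun s => - x s) (fun s => - g s)).
  - exists B. intros s. rewrite Rabs_Ropp. apply HB.
  - intros s. replace (- - x s + - g s) with (- (- x s + g s)) by ring.
    apply (is_derive_opp x), D.
  - intros s. specialize (HG s). lra.
Qed.

(** The value [0] is adjoined to the range, so that the hull reaches [0] even when the solution has
    constant sign. *)
Lemma range_upper_end (x : R -> R) (B : R) :
  0 <= B -> (forall t, x t <= B) ->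
  exists M, 0 <= M <= B /\ (forall t, x t <= M) /\
    forall G, 0 <= G -> (forall t, x t <= G) -> M <= G.
Proof.
  intros HB Hx.
  destruct (completeness (fun r => r = 0 \/ exists t, r = x t)) as [M [U L]].
  - exists B. intros r [->|[t ->]]; auto.
  - exists 0. now left.
  - exists M. repeat split.
    + apply U. now left.
    + apply L. intros r [->|[t ->]]; auto.
    + intros t. apply U. right. now exists t.
    + intros G HG H. apply L. intros r [->|[t ->]]; auto.
Qed.

Lemma feedback_of_hypotheses (f : R -> R) :
  class_C 3 f -> H1 f -> H2 f -> H3 f ->
  feedback f (Derive f) (Derive_n f 2) (Derive_n f 3).
Proof.
  intros [Ex C3] [S S0] [_ [U E]] Sc. split.
  - intros x. apply Derive_correct, (Ex 1%nat). auto.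
  - intros x. apply Derive_correct, (Ex 2%nat). auto.
  - intros x. apply Derive_correct, (Ex 3%nat). auto.
  - exact C3.
  - exact S.
  - exact S0.
  - exact U.
  - exact E.
  - intros x Hx. apply Sc. intros a Ha ->. exact (Hx Ha).
Qed.

(** The delay enters only through the values [x (t - h)], which stay in the hull [[- m, M]]. The
    extremes of [f] there bound [x], hence also [M] and [m], and [p] and [q] lie in that hull. *)
Lemma solution_extremal_pair f f1 f2 f3 zeta h x (B : R) :
  feedback f f1 f2 f3 -> 1 <= zeta -> entire_solution f zeta h x -> bounded_fun x ->
  0 <= B -> (forall t, - B <= x t <= B) ->
  exists p q, - B <= p <= 0 /\ 0 <= q <= B /\
    (forall y, 0 <= y < q -> f1 y < 0) /\
    (forall y, 0 <= y < - p -> f1 (- y) < 0) /\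
    q <= zeta * f p /\ zeta * f q <= p /\
    forall t, zeta * f q <= x t <= zeta * f p.
Proof.
  intros F Hz Hx Hb HB Bx. assert (F' := feedback_reflect _ _ _ _ F).
  destruct (range_upper_end x B HB) as [M [HM [UM LM]]]; [apply Bx|].
  destruct (range_upper_end (fun t => - x t) B HB) as [m [Hm [Um Lm]]].
  { intros t. specialize (Bx t). lra. }
  assert (Cf : forall y, continuity_pt f y).
  { intros y. apply continuity_pt_filterlim, is_derive_continuous with (f1 y).
    apply (fb_derive1 _ _ _ _ F). }
  assert (f0 := feedback_zero _ _ _ _ F).
  destruct (continuity_ab_min f 0 M) as [q [Qmin Hq]]; [lra|auto|].
  destruct (continuity_ab_maj f (- m) 0) as [p [Pmax Hp]]; [lra|auto|].
  assert (fq : f q <= 0) by (rewrite <- f0; apply Qmin; lra).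
  assert (fp : 0 <= f p) by (rewrite <- f0; apply Pmax; lra).
  (* The sign condition turns the one-sided extremes into extremes over the whole hull. *)
  assert (Fb : forall y, - m <= y <= M -> f q <= f y <= f p).
  { intros y Hy. destruct (Rtotal_order y 0) as [N|[->|N]].
    - assert (0 < f y) by (assert (S := fb_sign _ _ _ _ F y); nra).
      assert (f y <= f p) by (apply Pmax; lra). lra.
    - lra.
    - assert (f y < 0) by exact (feedback_neg _ _ _ _ y F N).
      assert (f q <= f y) by (apply Qmin; lra). lra. }
  assert (Rx : forall t, f q <= f (x t) <= f p).
  { intros t. apply Fb. specialize (UM t). specialize (Um t). simpl in Um. lra. }
  assert (Up : forall t, x t <= zeta * f p).
  { apply (bounded_solution_le x (fun t => zeta * f (x (t - h)))); [exact Hb|exact Hx|].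
    intros t. apply Rmult_le_compat_l; [lra|apply Rx]. }
  assert (Lo : forall t, zeta * f q <= x t).
  { apply (bounded_solution_ge x (fun t => zeta * f (x (t - h)))); [exact Hb|exact Hx|].
    intros t. apply Rmult_le_compat_l; [lra|apply Rx]. }
  exists p, q. repeat split; try lra.
  - apply (decreasing_before_argmin _ _ _ _ M q F Hq Qmin).
  (* The maximizer [p] of [f] becomes the minimizer [- p] of the reflection. *)
  - apply (decreasing_before_argmin _ _ _ _ m (- p) F'); [lra|].
    intros y Hy. rewrite Ropp_involutive. apply Ropp_le_contravar, Pmax. lra.
  - apply Rle_trans with M; [lra|]. apply LM; [nra|exact Up].
  - assert (m <= - (zeta * f q)); [|lra]. apply Lm; [nra|].
    intros t. specialize (Lo t). lra.
  - apply Lo.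
  - apply Up.
Qed.

(** The lower bound of [f] bounds [x] below by [- (2 * L)]. Above that level [f] is at most its
    maximum over [[- (2 * L), 0]], which bounds [x] above. *)
Lemma a_priori_bound f f1 f2 f3 :
  feedback f f1 f2 f3 -> bounded_below f ->
  exists B, 0 <= B /\ forall zeta h x, 0 <= zeta <= 2 ->
    entire_solution f zeta h x -> bounded_fun x -> forall t, - B <= x t <= B.
Proof.
  intros F [m Hm]. set (L := Rabs m).
  assert (HL : 0 <= L) by apply Rabs_pos.
  assert (fL : forall y, - L <= f y).
  { intros y. assert (P := Rle_abs (- m)). rewrite Rabs_Ropp in P. specialize (Hm y).
    unfold L. lra. }
  destruct (continuity_ab_maj f (- (2 * L)) 0) as [p [Pmax Hp]]; [lra| |].
  { intros y _. apply continuity_pt_filterlim, is_derive_continuous with (f1 y).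
    apply (fb_derive1 _ _ _ _ F). }
  assert (fp : 0 <= f p) by (rewrite <- (feedback_zero _ _ _ _ F); apply Pmax; lra).
  exists (2 * L + 2 * f p). split; [lra|]. intros zeta h x Hz Hx Hb.
  assert (Lo : forall t, - (2 * L) <= x t).
  { apply (bounded_solution_ge x (fun t => zeta * f (x (t - h)))); [exact Hb|exact Hx|].
    intros t. specialize (fL (x (t - h))). nra. }
  assert (Up : forall t, x t <= 2 * f p).
  { apply (bounded_solution_le x (fun t => zeta * f (x (t - h)))); [exact Hb|exact Hx|].
    intros t. assert (f (x (t - h)) <= f p); [|nra].
    destruct (Rlt_dec 0 (x (t - h))) as [N|N].
    - assert (P := feedback_neg _ _ _ _ _ F N). lra.
    - apply Pmax. specialize (Lo (t - h)). lra. }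
  intros t. specialize (Lo t). specialize (Up t). lra.
Qed.

(** * The square-root estimate *)

Theorem theorem10 (f : R -> R) (f_C3 : class_C 3 f)
    (f_H1 : H1 f) (f_H2 : H2 f) (f_H3 : H3 f) :
  exists eps1 K1 : R, 0 < eps1 /\ 0 < K1 /\
    forall zeta h : R, 0 <= zeta - 1 <= eps1 -> 0 <= h ->
    forall x : R -> R, entire_solution f zeta h x -> bounded_fun x ->
      Rbar_le (sup_abs x) (Finite (K1 * sqrt (zeta - 1))).
Proof.
  assert (F := feedback_of_hypotheses f f_C3 f_H1 f_H2 f_H3).
  destruct f_H2 as [f_below _].
  assert (f0 := feedback_zero _ _ _ _ F).
  destruct (a_priori_bound _ _ _ _ F f_below) as [B [HB Bx]].
  destruct (pair_product_bound _ _ _ _ B F) as [c [Hc Pair]].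
  destruct (linear_growth _ _ _ _ B F) as [C [HC Lin]].
  assert (HK : 0 < 8 * C ^ 3 / c) by (apply Rdiv_lt_0_compat; [assert (P := pow_lt C 3 HC); lra|lra]).
  (* The value [1] keeps [zeta <= 2] for the a priori bound. Up to symmetry, [x ^ 2 <= (2 * C * q) ^
     2 <= 8 * C ^ 3 * (q * - p) <= 8 * C ^ 3 * (zeta - 1) / c]. *)
  exists 1, (sqrt (8 * C ^ 3 / c)).
  split; [lra|]. split; [now apply sqrt_lt_R0|].
  intros zeta h Hz _ x Hx Hb. rewrite <- sqrt_mult by lra.
  apply (proj2 (Lub_Rbar_correct (fun r => exists t : R, r = Rabs (x t)))).
  intros r [t ->]. simpl.
  specialize (Bx zeta h x ltac:(lra) Hx Hb).
  destruct (solution_extremal_pair _ _ _ _ zeta h x B F ltac:(lra) Hx Hb HB Bx)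
    as [p [q [Hp [Hq [Nq [Np [Iq [Ip Hxt]]]]]]]].
  specialize (Hxt t).
  assert (Lp : zeta * f p <= 2 * C * - p).
  { assert (A := Lin p ltac:(lra)). rewrite (Rabs_left1 p) in A by lra.
    assert (A' := Rle_abs (f p)). nra. }
  assert (Lq : - (zeta * f q) <= 2 * C * q).
  { assert (A := Lin q ltac:(lra)). rewrite (Rabs_pos_eq q) in A by lra.
    assert (A' := Rle_abs (- f q)). rewrite Rabs_Ropp in A'. nra. }
  assert (Prod : q * - p <= (zeta - 1) / c).
  { apply Rmult_le_reg_l with c; [lra|].
    replace (c * ((zeta - 1) / c)) with (zeta - 1) by (field; lra).
    (* [Pair] asks for nonzero points; if either is [0], so is the product. *)
    destruct (Req_dec p 0) as [->|np]; [lra|].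
    destruct (Req_dec q 0) as [->|nq]; [lra|].
    apply Pair; auto; lra. }
  apply Rsqr_incr_0_var; [|apply sqrt_pos].
  unfold Rsqr. rewrite <- Rabs_mult, sqrt_sqrt by nra.
  rewrite Rabs_pos_eq by nra.
  apply Rle_trans with (8 * C ^ 3 * (q * - p)).
  2: { apply Rle_trans with (8 * C ^ 3 * ((zeta - 1) / c)); [|right; field; lra].
       apply Rmult_le_compat_l; [assert (P := pow_lt C 3 HC); lra|exact Prod]. }
  assert (Q1 : q <= 2 * C * - p) by lra.
  assert (Q2 : - p <= 2 * C * q) by lra.
  assert (0 < C ^ 2) by now apply pow_lt.
  destruct (Rle_dec 0 (x t)).
  - apply Rle_trans with ((2 * C * - p) * (2 * C * - p)); [apply Rmult_le_compat; lra|].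
    assert (- p * - p <= 2 * C * (q * - p)) by nra.
    replace (8 * C ^ 3 * (q * - p)) with (4 * C ^ 2 * (2 * C * (q * - p))) by ring.
    nra.
  - apply Rle_trans with ((2 * C * q) * (2 * C * q)).
    { replace (x t * x t) with (- x t * - x t) by ring. apply Rmult_le_compat; lra. }
    assert (q * q <= 2 * C * (q * - p)) by nra.
    replace (8 * C ^ 3 * (q * - p)) with (4 * C ^ 2 * (2 * C * (q * - p))) by ring.
    nra.
Qed.
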